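(* Let $G_n=\overline{C_n}$ be the graph complement of the cycle graph $C_n$ with $n$ vertices. If $x_1,\dots,x_k$ are vertices in $G_n$, then $H=S(x_1)\cap\cdots\cap S(x_k)$ is the graph complement of a subgraph of $C_n$ in which the vertices $x_1,\dots,x_k$ are deleted. These graphs $H$ are joins of spheres or contractible graphs, and so are themselves all either a sphere or contractible, where ''sphere'' means a graph homotopic to a $d$-sphere for some $d$. The genus $1-\chi(H)$ of $H$ is in $\{-1,0,1\}$.
   Context: All graphs are finite and simple. The unit sphere $S(x)$ of a vertex $x$ is the subgraph induced by the vertices adjacent to $x$. The (Zykov) join of graphs is their disjoint union together with all edges between vertices of different summands. The Euler characteristic is $\chi(H)=\sum_{j\ge 0}(-1)^j f_j(H)$, with $f_j(H)$ the number of complete subgraphs $K_{j+1}$ of $H$. A graph is contractible if it is the one-point graph $K_1$ or (inductively) if it has a vertex $x$ such that both $S(x)$ and the graph with $x$ removed are contractible. A homotopy extension of a graph adds a new vertex joined exactly to the vertices of a contractible subgraph; a homotopy reduction is the reverse, removing a vertex whose unit sphere is contractible. Two graphs are homotopic if one is obtained from the other by finitely many homotopy extensions and reductions. The $0$-sphere is the graph with two vertices and no edges; for $d\ge 1$, a $d$-sphere is inductively a graph all of whose unit spheres are $(d-1)$-spheres and which becomes contractible after removing some vertex.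
   Formalization: The empty graph is counted as a sphere (the (-1)-sphere), since H can be empty (e.g. n = 3), when it is neither contractible nor homotopic to a d-sphere with d ≥ 0; also n ≥ 3 and k ≥ 1 are assumed. *)

(* Defs.v *)
From mathcomp Require Import all_boot all_algebra.

Set Implicit Arguments.
Unset Strict Implicit.
Unset Printing Implicit Defensive.

Import GRing.Theory.

Record sgraph := SGraph {
  vertex :> finType;
  edge : rel vertex;
  edge_sym : symmetric edge;
  edge_irrefl : irreflexive edge
}.

Definition is_iso (G H : sgraph) (f : G -> H) : Prop :=
  bijective f /\ forall u v : G, edge (f u) (f v) = edge u v.

Definition isomorphic (G H : sgraph) : Prop := exists f : G -> H, is_iso f.

(* The complement of G is connected exactly when G is nonempty and is not the
   join of two nonempty graphs. *)
Definition connected (G : sgraph) : Prop :=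
  0 < #|G| /\ forall u v : G, connect (@edge G) u v.

Section Induced.
Variables (G : sgraph) (A : {set G}).

Definition induced_edge : rel {v : G | v \in A} :=
  fun u v => edge (val u) (val v).

Fact induced_sym : symmetric induced_edge.
Proof. by move=> u v; apply: edge_sym. Qed.

Fact induced_irrefl : irreflexive induced_edge.
Proof. by move=> u; apply: edge_irrefl. Qed.

Definition induced : sgraph := SGraph induced_sym induced_irrefl.
End Induced.

Definition nbhd (G : sgraph) (x : G) : {set G} := [set y | edge x y].

Definition unit_sphere (G : sgraph) (x : G) : sgraph := induced (nbhd x).

Definition remove_vertex (G : sgraph) (x : G) : sgraph := induced [set~ x].

(* Unit spheres are induced subgraphs, so their intersection is the subgraph
   induced by the common neighbours. *)
Definition sphere_intersection (G : sgraph) (k : nat) (x : 'I_k -> G) : sgraph :=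
  induced (\bigcap_(i < k) nbhd (x i)).

Section Complement.
Variable G : sgraph.

Definition compl_edge : rel G := fun u v => (u != v) && ~~ edge u v.

Fact compl_sym : symmetric compl_edge.
Proof. by move=> u v; rewrite /compl_edge eq_sym edge_sym. Qed.

Fact compl_irrefl : irreflexive compl_edge.
Proof. by move=> u; rewrite /compl_edge eqxx. Qed.

Definition compl : sgraph := SGraph compl_sym compl_irrefl.
End Complement.

Section Cycle.
Variable n : nat.

Definition cycle_edge : rel 'I_n :=
  fun i j => (i != j) && ((i.+1 %% n == j) || (j.+1 %% n == i)).

Fact cycle_sym : symmetric cycle_edge.
Proof. by move=> i j; rewrite /cycle_edge eq_sym orbC. Qed.

Fact cycle_irrefl : irreflexive cycle_edge.
Proof. by move=> i; rewrite /cycle_edge eqxx. Qed.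

Definition cycle_graph : sgraph := SGraph cycle_sym cycle_irrefl.
End Cycle.

Section Join.
Variables (I : finType) (J : I -> sgraph).

Definition join_edge : rel {i : I & J i} :=
  fun p q => (tag p != tag q) || edge (tagged p) (tagged_as p q).

Fact join_sym : symmetric join_edge.
Proof.
move=> [i u] [j v]; rewrite /join_edge /=.
case: (eqVneq i j) v => [<-|//] v /=.
by rewrite !tagged_asE edge_sym.
Qed.

Fact join_irrefl : irreflexive join_edge.
Proof. by move=> [i u]; rewrite /join_edge /= eqxx tagged_asE edge_irrefl. Qed.

Definition zykov_join : sgraph := SGraph join_sym join_irrefl.
End Join.

Section AddVertex.
Variables (G : sgraph) (A : {set G}).

Definition add_vertex_edge : rel (option G) := fun u v =>
  match u, v with
  | Some a, Some b => edge a b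
  | Some a, None | None, Some a => a \in A
  | None, None => false
  end.

Fact add_vertex_sym : symmetric add_vertex_edge.
Proof. by move=> [a|] [b|] //=; apply: edge_sym. Qed.

Fact add_vertex_irrefl : irreflexive add_vertex_edge.
Proof. by move=> [a|] //=; apply: edge_irrefl. Qed.

Definition add_vertex : sgraph := SGraph add_vertex_sym add_vertex_irrefl.
End AddVertex.

Inductive contractible : sgraph -> Prop :=
| contractible_point (G : sgraph) : #|G| = 1 -> contractible G
| contractible_step (G : sgraph) (x : G) :
    contractible (unit_sphere x) -> contractible (remove_vertex x) ->
    contractible G.

Definition homotopy_extension (G H : sgraph) : Prop :=
  exists2 A : {set G}, contractible (induced A) & isomorphic (add_vertex A) H.

Definition homotopy_reduction (G H : sgraph) : Prop :=
  exists2 x : G, contractible (unit_sphere x) & isomorphic (remove_vertex x) H.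

Inductive homotopic (G : sgraph) : sgraph -> Prop :=
| homotopic_iso (H : sgraph) : isomorphic G H -> homotopic G H
| homotopic_ext (H K : sgraph) :
    homotopic G H -> homotopy_extension H K -> homotopic G K
| homotopic_red (H K : sgraph) :
    homotopic G H -> homotopy_reduction H K -> homotopic G K.

Fixpoint dsphere (d : nat) (G : sgraph) : Prop :=
  match d with
  | 0 => #|G| = 2 /\ forall u v : G, ~~ edge u v
  | d'.+1 => (forall x : G, dsphere d' (unit_sphere x)) /\
             exists x : G, contractible (remove_vertex x)
  end.

(* The empty graph counts as the (-1)-sphere. It is homotopic only to itself,
   since the empty graph is not contractible, so this case concerns empty
   graphs only. *)
Definition homotopy_sphere (G : sgraph) : Prop :=
  exists2 S : sgraph, #|S| = 0 \/ (exists d : nat, dsphere d S) & homotopic G S.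

Definition clique (G : sgraph) (A : {set G}) : bool :=
  [forall u in A, forall v in A, (u != v) ==> edge u v].

Definition num_complete (G : sgraph) (j : nat) : nat :=
  #|[set A : {set G} | clique A & #|A| == j.+1]|.

Definition euler_char (G : sgraph) : int :=
  (\sum_(j < #|G|) (-1) ^+ j * (num_complete G j)%:Z)%R.

Definition genus (G : sgraph) : int := (1 - euler_char G)%R.

(* Main.v *)
Require Import Defs.
From mathcomp Require Import all_boot all_algebra.

(** Write [F] for the graph complement of [H]; it is the subgraph of the cycle
    induced by the vertices at distance at least 2 from every [x i].  Since
    [k > 0] at least one vertex of the cycle is missing, so [F] is a disjoint
    union of paths: every nonempty set of vertices of [F] contains a vertex with
    at most one [F]-neighbour in the set ([coforest_sphere_intersection]).  This
    degeneracy property is all that is used of [F], and it passes to subsets,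
    which makes an induction on the vertex set possible
    ([coforest_sphere_or_contractible]).  Pick a vertex [b] with at most one
    [F]-neighbour.

    - If it has none, then [b] is joined to everything in the complement, which
      is therefore a cone, hence contractible.
    - If its only neighbour [u] has a further neighbour [w], then the unit sphere
      of [w] in the complement is a cone with apex [b], so that [w] can be removed
      by a homotopy reduction.
    - If [b] and [u] are only adjacent to each other, then the complement is the
      suspension, with poles [b] and [u], of what remains.  Suspension preserves
      contractibility ([contractible_susp]), homotopy ([homotopic_susp]) and
      spheres ([dsphere_susp]).

    The join decomposition is that of any graph into the pieces spanned by the
    connected components of its complement ([join_decomposition]); the pieces
    inherit the dichotomy because it holds for every induced subgraph of [H].

    Finally the genus is the alternating count of all cliques, the empty one
    included ([genusE]).  Sorting the cliques by whether they contain [x] gives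
    [genus G = genus (G - x) - genus (S x)].  Hence contractible graphs have genus
    0, homotopic graphs have the same genus, and a sphere of dimension d has genus
    [(-1) ^ (d + 1)]. *)

Set Implicit Arguments.
Unset Strict Implicit.
Unset Printing Implicit Defensive.

Import GRing.Theory.

(** * Embeddings and isomorphisms *)

Definition embedding (G H : sgraph) (f : G -> H) : Prop :=
  injective f /\ forall u v : G, edge (f u) (f v) = edge u v.

Lemma embedding_comp (G H K : sgraph) (f : G -> H) (g : H -> K) :
  embedding f -> embedding g -> embedding (g \o f).
Proof.
move=> [fI fE] [gI gE]; split; first exact: inj_comp.
by move=> u v /=; rewrite gE fE.
Qed.

Definition in_induced (G : sgraph) (A : {set G}) (v : G) (vA : v \in A) :
  induced A := exist _ v vA.

Lemma embedding_val (G : sgraph) (A : {set G}) :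
  embedding (val : induced A -> G).
Proof. by split; [exact: val_inj | move=> u v]. Qed.

Lemma is_iso_embedding (G H : sgraph) (f : G -> H) : is_iso f -> embedding f.
Proof. by case=> /bij_inj. Qed.

Lemma onto_isomorphic (G H : sgraph) (f : G -> H) :
  embedding f -> (forall y, exists u, f u = y) -> isomorphic G H.
Proof.
move=> [fI fE] fS; exists f; split=> //.
have yP y : exists u, f u == y by have [u <-] := fS y; exists u.
exists (fun y => xchoose (yP y)) => [u|y]; last exact/eqP/(xchooseP (yP y)).
exact/fI/eqP/(xchooseP (yP _)).
Qed.

(** All isomorphisms between the graphs built below come from here: both graphs
    are recognised as copies of the same induced subgraph of an ambient graph,
    which avoids iterated subtypes. *)
Lemma embedding_isomorphic (G H : sgraph) (f : G -> H) (B : {set H}) :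
  embedding f -> (forall u, f u \in B) ->
  (forall y, y \in B -> exists u, f u = y) -> isomorphic G (induced B).
Proof.
move=> [fI fE] fB fS.
apply: (@onto_isomorphic _ _ (fun u => in_induced (fB u))).
  by split=> [u v [/fI]|u v] //; exact: fE.
move=> [y yB]; have [u fu] := fS y yB; exists u.
exact: val_inj.
Qed.

Lemma isomorphic_refl (G : sgraph) : isomorphic G G.
Proof. by exists id; split=> //; exists id. Qed.

Lemma isomorphic_sym (G H : sgraph) : isomorphic G H -> isomorphic H G.
Proof.
case=> f [[g fK gK] fE]; exists g; split; first by exists f.
by move=> u v; rewrite -fE !gK.
Qed.

Lemma isomorphic_trans (G H K : sgraph) :
  isomorphic G H -> isomorphic H K -> isomorphic G K.
Proof.
case=> f [fB fE] [g [gB gE]]; exists (g \o f); split; first exact: bij_comp.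
by move=> u v /=; rewrite gE fE.
Qed.

Lemma isomorphic_induced_setT (G : sgraph) : isomorphic G (induced [set: G]).
Proof.
apply: (@embedding_isomorphic _ _ id) => [|u|y _]; last by exists y.
  by split=> // u v.
by rewrite inE.
Qed.

Lemma isomorphic_unit_sphere (G H : sgraph) (f : G -> H) (x : G) :
  is_iso f -> isomorphic (unit_sphere x) (unit_sphere (f x)).
Proof.
move=> fiso; have [[g fK gK] fE] := fiso.
apply: (@embedding_isomorphic (unit_sphere x) H (f \o val)).
- exact: embedding_comp (embedding_val _) (is_iso_embedding fiso).
- by case=> u /= xu; rewrite inE fE; rewrite inE in xu.
move=> y; rewrite inE => xy.
have xg : g y \in nbhd x by rewrite inE -fE gK.
by exists (in_induced xg); exact: gK.
Qed.

Lemma isomorphic_remove_vertex (G H : sgraph) (f : G -> H) (x : G) :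
  is_iso f -> isomorphic (remove_vertex x) (remove_vertex (f x)).
Proof.
move=> fiso; have [[g fK gK] fE] := fiso.
apply: (@embedding_isomorphic (remove_vertex x) H (f \o val)).
- exact: embedding_comp (embedding_val _) (is_iso_embedding fiso).
- by case=> u /= xu; rewrite !inE (can_eq fK); rewrite !inE in xu.
move=> y; rewrite !inE => xy.
have xg : g y \in [set~ x] by rewrite !inE -(can_eq fK) gK.
by exists (in_induced xg); exact: gK.
Qed.

Lemma card_isomorphic (G H : sgraph) : isomorphic G H -> #|G| = #|H|.
Proof. by case=> f [/bij_eq_card]. Qed.

Lemma card_induced (G : sgraph) (A : {set G}) : #|induced A| = #|A|.
Proof. by rewrite card_sig; apply: eq_card. Qed.

Lemma contractible_isomorphic (G H : sgraph) :
  contractible G -> isomorphic G H -> contractible H.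
Proof.
move=> cG; elim: cG H => {G} [G G1|G x _ IHS _ IHR] H.
  by move=> /card_isomorphic GH; apply: contractible_point; rewrite -GH.
case=> f fiso; apply: (@contractible_step _ (f x)).
  exact/IHS/isomorphic_unit_sphere.
exact/IHR/isomorphic_remove_vertex.
Qed.

Lemma dsphere_isomorphic (d : nat) (G H : sgraph) :
  dsphere d G -> isomorphic G H -> dsphere d H.
Proof.
elim: d G H => [|d IHd] G H /=.
  move=> [G2 Gn] GH; split; first by rewrite -(card_isomorphic GH).
  have [f [[g fK gK] fE]] := GH.
  by move=> u v; rewrite -(gK u) -(gK v) fE.
move=> [Gs [x Gx]] [f fiso]; have [[g fK gK] fE] := fiso.
split=> [y|].
  by rewrite -(gK y); apply: IHd (Gs (g y)) _; apply: isomorphic_unit_sphere.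
exists (f x); apply: contractible_isomorphic Gx _.
exact: isomorphic_remove_vertex.
Qed.

(** * Homotopy *)

(** A homotopy is thus a chain of reductions, some of them reversed, so that any
    construction or invariant compatible with reductions is compatible with
    homotopy. *)
Lemma homotopy_extension_reduction (G H : sgraph) :
  homotopy_extension G H <-> homotopy_reduction H G.
Proof.
split.
  case=> A cA [f fiso]; exists (f None).
    apply: contractible_isomorphic (isomorphic_unit_sphere _ fiso).
    apply: contractible_isomorphic cA _.
    apply: (@embedding_isomorphic (induced A) (add_vertex A) (Some \o val)).
    - by split=> // u v [/val_inj].
    - by case=> u uA; rewrite inE.
    case=> [y|]; rewrite inE //= => yA.
    by exists (in_induced yA).
  have fR := isomorphic_remove_vertex (None : add_vertex A) fiso.
  apply: isomorphic_trans (isomorphic_sym fR) _.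
  apply: isomorphic_sym.
  apply: (@embedding_isomorphic G (add_vertex A) Some).
  - by split=> // u v [].
  - by move=> u; rewrite !inE.
  by case=> [y|]; rewrite !inE //= => _; exists y.
case=> x cx [f fiso]; have [[g fK gK] fE] := fiso.
have gE a b : edge (g a) (g b) = edge a b by rewrite -fE !gK.
exists [set y | edge x (val (g y))].
  apply: contractible_isomorphic cx _; apply: isomorphic_sym.
  apply: (@embedding_isomorphic (induced _) H (val \o (g \o val))).
  - apply: embedding_comp (embedding_val _).
    apply: embedding_comp (embedding_val _) _.
    by split=> [|u v]; [exact: can_inj gK | exact: gE].
  - by case=> u uA; rewrite inE /=; rewrite inE in uA.
  move=> y; rewrite inE => xy.
  have yx : y \in [set~ x].
    by rewrite !inE; apply: contraL xy => /eqP->; rewrite edge_irrefl.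
  have fA : f (in_induced yx) \in [set z | edge x (val (g z))].
    by rewrite inE fK.
  by exists (in_induced fA); rewrite /= fK.
pose h (u : add_vertex [set y | edge x (val (g y))]) : H :=
  if u is Some a then val (g a) else x.
apply: (@onto_isomorphic _ _ h).
  have gx a : val (g a) == x = false.
    by have := valP (g a); rewrite !inE => /negbTE.
  split=> [[a|] [b|]|[a|] [b|]] //=.
  - by move/val_inj/(can_inj gK)->.
  - by move/eqP; rewrite gx.
  - by move/esym/eqP; rewrite gx.
  - by rewrite -[RHS](gE a b).
  - by rewrite inE edge_sym.
  - by rewrite inE.
  - by rewrite edge_irrefl.
move=> y; have [->|yx] := eqVneq y x; first by exists None.
have yx' : y \in [set~ x] by rewrite !inE.
by exists (Some (f (in_induced yx'))); rewrite /= fK.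
Qed.

Lemma homotopic_trans (G H K : sgraph) :
  homotopic G H -> homotopic H K -> homotopic G K.
Proof.
move=> GH HK; elim: HK => {K} [K HK|K L _ IH KL|K L _ IH KL].
- case: GH HK => {H} [H GH|H L GH [A cA AL]|H L GH [y cy yL]] LK.
  + exact: homotopic_iso (isomorphic_trans GH LK).
  + apply: homotopic_ext GH _; exists A => //; exact: isomorphic_trans AL LK.
  + apply: homotopic_red GH _; exists y => //; exact: isomorphic_trans yL LK.
- exact: homotopic_ext IH KL.
- exact: homotopic_red IH KL.
Qed.

Lemma homotopic_sphere (G H : sgraph) :
  homotopic G H -> homotopy_sphere H -> homotopy_sphere G.
Proof. by move=> GH [S hS HS]; exists S => //; apply: homotopic_trans HS. Qed.

Definition sphere_or_contractible (G : sgraph) : Prop :=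
  homotopy_sphere G \/ contractible G.

Lemma sphere_or_contractible_isomorphic (G H : sgraph) :
  isomorphic G H -> sphere_or_contractible G -> sphere_or_contractible H.
Proof.
move=> GH [sG|cG]; last by right; apply: contractible_isomorphic cG GH.
left; apply: homotopic_sphere sG.
exact/homotopic_iso/isomorphic_sym.
Qed.

Lemma sphere_or_contractible_reduction (G : sgraph) (x : G) :
  contractible (unit_sphere x) -> sphere_or_contractible (remove_vertex x) ->
  sphere_or_contractible G.
Proof.
move=> cx [sR|cR]; last by right; apply: contractible_step cx cR.
left; apply: homotopic_sphere sR.
apply: homotopic_red (homotopic_iso (isomorphic_refl G)) _.
by exists x => //; apply: isomorphic_refl.
Qed.

(** * Cones and suspensions *)

(** Removing any vertex other than the apex leaves a cone, and the unit sphere of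
    that vertex is a cone too. *)
Lemma contractible_cone (G : sgraph) (a : G) :
  (forall v, v != a -> edge a v) -> contractible G.
Proof.
have [m] := ubnP #|G|; elim: m => // m IHm in G a * => /ltnSE Gm aG.
have [x xa|noG] := pickP [pred x : G | x != a]; last first.
  apply: contractible_point; apply/eqP/fintype1P; exists a => y.
  by apply/eqP/negbFE/noG.
have lt_x (A : {set G}) : x \notin A -> #|induced A| < m.
  move=> xA; rewrite card_induced; apply: leq_trans Gm.
  by rewrite -cardsT; apply/proper_card/properP; split; [|exists x].
apply: (@contractible_step _ x).
  have ax : a \in nbhd x by rewrite inE edge_sym aG.
  apply: (IHm _ (in_induced ax)).
    by apply: lt_x; rewrite inE edge_irrefl.
  by case=> v vx va; apply: aG.
have ax : a \in [set~ x] by rewrite !inE eq_sym.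
apply: (IHm _ (in_induced ax)).
  by apply: lt_x; rewrite !inE eqxx.
by case=> v vx va; apply: aG.
Qed.

Section Suspension.
Variable G : sgraph.

Definition susp_edge : rel (G + bool)%type := fun p q =>
  match p, q with
  | inl u, inl v => edge u v
  | inr _, inr _ => false
  | _, _ => true
  end.

Fact susp_sym : symmetric susp_edge.
Proof. by move=> [u|b] [v|c] //=; apply: edge_sym. Qed.

Fact susp_irrefl : irreflexive susp_edge.
Proof. by move=> [u|b] //=; apply: edge_irrefl. Qed.

Definition susp : sgraph := SGraph susp_sym susp_irrefl.
End Suspension.

Definition susp_map (G H : sgraph) (f : G -> H) (p : susp G) : susp H :=
  match p with inl u => inl (f u) | inr b => inr b end.

Lemma embedding_susp (G H : sgraph) (f : G -> H) :
  embedding f -> embedding (susp_map f).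
Proof.
move=> [fI fE]; split=> [[u|b] [v|c]|[u|b] [v|c]] //=.
  by case=> /fI->.
by case=> ->.
Qed.

Lemma isomorphic_susp (G H : sgraph) :
  isomorphic G H -> isomorphic (susp G) (susp H).
Proof.
case=> f fiso; have [[g fK gK] fE] := fiso.
apply: onto_isomorphic (embedding_susp (is_iso_embedding fiso)) _.
by case=> [y|b]; [exists (inl (g y)); rewrite /= gK | exists (inr b)].
Qed.

Lemma susp_induced (G : sgraph) (A : {set G}) (B : {set susp G}) :
  (forall v : G, (inl v \in B) = (v \in A)) -> (forall b, inr b \in B) ->
  isomorphic (susp (induced A)) (induced B).
Proof.
move=> AB poleB.
apply: embedding_isomorphic (embedding_susp (embedding_val A)) _ _.
  by case=> [[u uA]|b]; [rewrite [_ \in B]AB | exact: poleB].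
case=> [y|b]; last by exists (inr b).
by rewrite AB => yA; exists (inl (in_induced yA)).
Qed.

Lemma susp_unit_sphere (G : sgraph) (x : G) :
  isomorphic (susp (unit_sphere x)) (@unit_sphere (susp G) (inl x)).
Proof. by apply: susp_induced => [v|b]; rewrite !inE. Qed.

Lemma susp_remove_vertex (G : sgraph) (x : G) :
  isomorphic (susp (remove_vertex x)) (@remove_vertex (susp G) (inl x)).
Proof. by apply: susp_induced => [v|b]; rewrite !inE. Qed.

Lemma susp_unit_sphere_pole (G : sgraph) (b : bool) :
  isomorphic G (@unit_sphere (susp G) (inr b)).
Proof.
apply: (@embedding_isomorphic _ (susp G) inl).
- by split=> // u v [].
- by move=> u; rewrite inE.
by case=> [y|c]; rewrite inE //; exists y.
Qed.

Lemma contractible_susp_remove_pole (G : sgraph) (b : bool) :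
  contractible (@remove_vertex (susp G) (inr b)).
Proof.
have bb : (inr (~~ b) : susp G) \in [set~ (inr b : susp G)].
  by rewrite !inE; case: b.
apply: (@contractible_cone (@remove_vertex (susp G) (inr b)) (in_induced bb)).
case=> [[v|c] vb] // cb; have := vb; move: cb.
by rewrite -(inj_eq val_inj) !inE /=; case: b c {vb} bb => [] [].
Qed.

Lemma contractible_susp (G : sgraph) : contractible G -> contractible (susp G).
Proof.
elim=> {G} [G /eqP/fintype1P[x xG]|G x _ IHS _ IHR].
  apply: (@contractible_cone (susp G) (inl x)) => -[v|//].
  by rewrite xG eqxx.
apply: (@contractible_step (susp G) (inl x)).
  exact: contractible_isomorphic IHS (susp_unit_sphere x).
exact: contractible_isomorphic IHR (susp_remove_vertex x).
Qed.

Lemma homotopy_reduction_susp (G H : sgraph) :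
  homotopy_reduction G H -> homotopy_reduction (susp G) (susp H).
Proof.
case=> x cx xH; exists (inl x).
  exact: contractible_isomorphic (contractible_susp cx) (susp_unit_sphere x).
apply: isomorphic_trans (isomorphic_susp xH).
exact: isomorphic_sym (susp_remove_vertex x).
Qed.

Lemma homotopic_susp (G H : sgraph) :
  homotopic G H -> homotopic (susp G) (susp H).
Proof.
elim=> {H} [H GH|H K _ IH HK|H K _ IH HK].
- exact/homotopic_iso/isomorphic_susp.
- apply: homotopic_ext IH _; apply/homotopy_extension_reduction.
  exact/homotopy_reduction_susp/homotopy_extension_reduction.
- exact: homotopic_red IH (homotopy_reduction_susp HK).
Qed.

Lemma dsphere_susp_empty (G : sgraph) : #|G| = 0 -> dsphere 0 (susp G).
Proof.
move=> G0; split; first by rewrite card_sum G0 card_bool.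
move=> [u|b]; first by have := fintype0 u G0.
by case=> [v|c] //; have := fintype0 v G0.
Qed.

(** The unit sphere of a pole is the original graph, that of any other vertex the
    suspension of its original unit sphere, and removing a pole leaves a cone. *)
Lemma dsphere_susp (d : nat) (G : sgraph) :
  dsphere d G -> dsphere d.+1 (susp G).
Proof.
elim: d G => [|d IHd] G sG.
  split=> [[x|b]|].
  - apply: dsphere_isomorphic (susp_unit_sphere x).
    apply: dsphere_susp_empty; rewrite card_induced.
    by apply: eq_card0 => y; rewrite inE (negbTE (sG.2 _ _)).
  - exact: dsphere_isomorphic sG (susp_unit_sphere_pole G b).
  - by exists (inr true); apply: contractible_susp_remove_pole.
split=> [[x|b]|].
- exact: dsphere_isomorphic (IHd _ (sG.1 x)) (susp_unit_sphere x).
- exact: dsphere_isomorphic sG (susp_unit_sphere_pole G b).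
- by exists (inr true); apply: contractible_susp_remove_pole.
Qed.

Lemma sphere_or_contractible_susp (G : sgraph) :
  sphere_or_contractible G -> sphere_or_contractible (susp G).
Proof.
move=> [[S hS GS]|cG]; last by right; apply: contractible_susp.
left; exists (susp S); last exact: homotopic_susp.
case: hS => [S0|[d dS]]; right; first by exists 0; apply: dsphere_susp_empty.
by exists d.+1; apply: dsphere_susp.
Qed.

(** * Complements of forests *)

(** The complement of [G] has no cycle: this is expressed by the existence, in
    every nonempty set of vertices, of a vertex that is isolated or a leaf of the
    induced subgraph of the complement. *)
Definition coforest (G : sgraph) : Prop :=
  forall B : {set G}, B != set0 ->
  exists2 b, b \in B & #|[set c in B | compl_edge b c]| <= 1.

(** Induction on the size of [A].  With [b] an isolated vertex or leaf of the
    complement of the subgraph on [A], that subgraph is a cone with apex [b], or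
    it can be reduced by removing a vertex at distance 2 from [b] in the
    complement, or it is a suspension in which [b] is one of the poles.  Quantifying
    over the subsets of a fixed graph keeps the smaller graphs of the same form. *)
Lemma coforest_sphere_or_contractible (G : sgraph) (A : {set G}) :
  coforest G -> sphere_or_contractible (induced A).
Proof.
move=> cG; have [m] := ubnP #|A|; elim: m => // m IHm in A * => /ltnSE Am.
have [A0|/cG[b bA]] := eqVneq A set0.
  left; exists (induced A); last exact/homotopic_iso/isomorphic_refl.
  by left; rewrite card_induced A0 cards0.
set N := [set c in A | _] => N1.
have inN c : (c \in N) = [&& c \in A, b != c & ~~ edge b c].
  by rewrite inE.
have [N0|[u uN]] := set_0Vmem N.
  right; apply: (@contractible_cone (induced A) (in_induced bA)).
  case=> c cA; rewrite -(inj_eq val_inj) /= eq_sym => bc; apply: contraT => nbc.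
  by have := inN c; rewrite N0 inE cA bc nbc.
have Nu c : c \in N -> c = u by move=> cN; exact: (card_le1_eqP N1).
have := uN; rewrite inN => /and3P[uA bu nbu].
have bE c : c \in A -> c != b -> c != u -> edge b c.
  move=> cA cb cu; apply: contraNT cu => nbc.
  by apply/eqP/Nu; rewrite inN cA eq_sym cb.
have [w /and4P[wA wb wu nuw]|noW] :=
    pickP [pred w | [&& w \in A, w != b, w != u & ~~ edge u w]].
  pose w' := in_induced wA.
  apply: (@sphere_or_contractible_reduction _ w').
    have bw : in_induced bA \in nbhd w'.
      by rewrite inE edge_sym; apply: bE.
    apply: (@contractible_cone (unit_sphere w') (in_induced bw)).
    move=> [[c cA] cw].
    rewrite -!(inj_eq val_inj) => cb; apply: (bE c) => //.
    have := cw; rewrite inE /= /induced_edge /= edge_sym.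
    by apply: contraTneq => ->.
  have : sphere_or_contractible (induced (A :\ w)).
    by apply: IHm; rewrite (cardsD1 w A) wA in Am.
  apply: sphere_or_contractible_isomorphic; apply: isomorphic_sym.
  have vE := embedding_comp (embedding_val [set~ w']) (embedding_val A).
  apply: embedding_isomorphic vE _ _.
    case=> [[c cA] cw]; have := cw.
    by rewrite !inE -(inj_eq val_inj) /= cA andbT.
  move=> c; rewrite !inE => /andP[cw cA].
  have cw' : in_induced cA \in [set~ w'].
    by rewrite !inE -(inj_eq val_inj).
  by exists (in_induced cw').
have uE c : c \in A -> c != b -> c != u -> edge u c.
  by move=> cA cb cu; have /= := noW c; rewrite cA cb cu /= => /negbFE.
have : sphere_or_contractible (susp (induced (A :\ b :\ u))).
  apply/sphere_or_contractible_susp/IHm; rewrite (cardsD1 b A) bA in Am.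
  by apply: leq_trans Am; rewrite ltnS subset_leq_card ?subsetDl.
apply: sphere_or_contractible_isomorphic.
have inD (v : induced (A :\ b :\ u)) :
    [/\ val v \in A, val v != b & val v != u].
  by have := valP v; rewrite !inE => /and3P[].
pose f (p : susp (induced (A :\ b :\ u))) : G :=
  match p with inl v => val v | inr c => if c then b else u end.
apply: (@embedding_isomorphic _ _ f).
- split=> [[v|c] [v'|c']|[v|c] [v'|c']] //=.
  + by move/val_inj->.
  + by have [_ /eqP vb /eqP vu] := inD v; case: c'.
  + by have [_ /eqP vb /eqP vu] := inD v'; case: c => // /esym.
  + move=> cc'; congr inr; move: cc' (elimN eqP bu).
    by case: c c' => [] [] // ->.
  + by have [vA vb vu] := inD v; case: c'; rewrite edge_sym ?bE ?uE.
  + by have [vA vb vu] := inD v'; case: c; rewrite ?bE ?uE.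
  + case: c c' => [] []; rewrite ?edge_irrefl ?(negbTE nbu) //.
    by rewrite edge_sym (negbTE nbu).
- by case=> [v|[]] //=; have [] := inD v.
move=> y yA; have [->|yb] := eqVneq y b; first by exists (inr true).
have [->|yu] := eqVneq y u; first by exists (inr false).
have yD : y \in A :\ b :\ u by rewrite !inE yA yb yu.
by exists (inl (in_induced yD)).
Qed.

(** * The join of co-components *)

(** Vertices in different components of the complement are adjacent, so a graph
    is the join of the subgraphs that these components span. *)
Lemma join_decomposition (G : sgraph) :
  exists (I : finType) (A : I -> {set G}),
    isomorphic G (zykov_join (fun i => induced (A i))) /\
    forall i, connected (compl (induced (A i))).
Proof.
pose e : rel G := @compl_edge G.
have eS : connect_sym e by apply: sym_connect_sym; apply: compl_sym.
pose I : finType := {r : G | roots e r}.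
pose A (i : I) := [set v | fingraph.root e v == val i].
have rootA v : v \in A (exist _ (fingraph.root e v) (roots_root eS v)).
  by rewrite inE.
exists I, A; split.
  pose f (v : G) : zykov_join (fun i => induced (A i)) :=
    Tagged (fun i => induced (A i)) (in_induced (rootA v)).
  apply: (@onto_isomorphic _ _ f).
    split=> [u v|u v].
      by move/(congr1 (fun p : zykov_join (fun i => induced (A i)) =>
                        val (tagged p))).
    rewrite /= /join_edge /=.
    case: eqVneq => [uv|ruv] /=; last first.
      symmetry; apply: contraNT ruv => nuv; rewrite -(inj_eq val_inj) /=.
      apply/eqP/fingraph.rootP => //.
      have [->|uv] := eqVneq u v; first exact: connect0.
      by apply: connect1; apply/andP.
    (* Both vertices lie in the same component; the transported second one still
       has v as underlying vertex. *)
    suff tv : forall j (w : induced (A j)) i (w' : induced (A i)), i = j ->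
        edge w' (tagged_as (Tagged (fun i => induced (A i)) w')
                           (Tagged (fun i => induced (A i)) w))
        = edge (val w') (val w) by exact: tv.
    by move=> j w i w' ij; case: _ / ij w => w; rewrite tagged_asE.
  move=> [i [v vA]]; exists v.
  have iv : exist _ (fingraph.root e v) (roots_root eS v) = i :> I.
    by apply: val_inj => /=; apply/eqP; rewrite inE in vA.
  rewrite /f; case: _ / iv vA => vA.
  by congr Tagged; apply: val_inj.
move=> i; have iA : val i \in A i by rewrite inE; exact: (valP i).
split; first by apply/card_gt0P; exists (in_induced iA).
have conn (u v : induced (A i)) : connect e (val u) (val v).
  apply/fingraph.rootP => //; have := valP u; have := valP v.
  by rewrite !inE => /eqP-> /eqP->.
move=> u v; have /connectP[p] := conn u v.
elim: p u => [|w p IHp] u /=.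
  by move=> _ /val_inj->; exact: connect0.
case/andP=> uw pw vlast.
have wA : w \in A i.
  have := valP u; rewrite !inE => /eqP <-; apply/eqP/fingraph.rootP => //.
  by rewrite eS; apply: connect1.
apply: connect_trans (IHp (in_induced wA) pw vlast); apply: connect1.
by rewrite /= /compl_edge -(inj_eq val_inj).
Qed.

(** * The genus *)

Local Open Scope ring_scope.

(** Counting the empty clique with sign +1 absorbs the constant 1. *)
Lemma genusE (G : sgraph) :
  genus G = \sum_(A : {set G} | clique A) (-1) ^+ #|A|.
Proof.
rewrite (partition_big (fun A : {set G} => inord #|A| : 'I_#|G|.+1) xpredT) //=.
have inordA (A : {set G}) (j : 'I_#|G|.+1) : (inord #|A| == j) = (#|A| == j).
  by rewrite -(inj_eq val_inj) /= inordK // ltnS max_card.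
rewrite big_ord_recl /genus /euler_char; congr (_ + _).
  rewrite (big_pred1 set0) ?cards0 // => A.
  rewrite inordA cards_eq0; apply/andP/eqP => [[_ /eqP//]|->].
  by split=> //; apply/forallP => u; rewrite inE.
rewrite -sumrN; apply: eq_bigr => j _.
rewrite (eq_bigr (fun _ => - (-1) ^+ j)) => [|A /andP[_]]; last first.
  by rewrite inordA => /eqP->; rewrite lift0 exprS mulN1r.
rewrite sumrN; congr (- _).
rewrite -natz /num_complete -sum1_card natr_sum mulr_sumr.
apply: eq_big => A; last by rewrite mulr1.
by rewrite inE inordA lift0.
Qed.

Lemma cliqueP (G : sgraph) (A : {set G}) :
  reflect {in A &, forall u v, u != v -> edge u v} (clique A).
Proof.
apply: (iffP idP) => [/forall_inP cA u v uA vA uv|cA].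
  by move/(_ u uA)/forall_inP/(_ v vA)/implyP: cA; apply.
by apply/forall_inP=> u uA; apply/forall_inP=> v vA; apply/implyP; apply: cA.
Qed.

Lemma clique_embedding (G H : sgraph) (f : G -> H) (A : {set G}) :
  embedding f -> clique (f @: A) = clique A.
Proof.
move=> [fI fE]; apply/cliqueP/cliqueP => cA.
  move=> u v uA vA uv; rewrite -fE; apply: cA; rewrite ?imset_f //.
  by rewrite inj_eq.
move=> _ _ /imsetP[u uA ->] /imsetP[v vA ->]; rewrite inj_eq // fE.
exact: cA.
Qed.

Lemma genus_induced (G : sgraph) (B : {set G}) :
  genus (induced B) =
    \sum_(A : {set G} | clique A && (A \subset B)) (-1) ^+ #|A|.
Proof.
have vE := embedding_val B.
rewrite genusE; symmetry.
rewrite (reindex_onto (fun A : {set induced B} => val @: A)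
                      (fun A : {set G} => val @^-1: A)) /=; last first.
  move=> A /andP[_ /subsetP AB]; apply/setP=> v.
  apply/imsetP/idP => [[u uA ->]|vA]; first by rewrite inE in uA.
  by exists (in_induced (AB v vA)) => //; rewrite inE.
apply: eq_big => [A|A _]; last by rewrite card_imset //; exact: val_inj.
rewrite (clique_embedding _ vE); have -> : val @: A \subset B.
  by apply/subsetP => _ /imsetP[u _ ->]; exact: valP.
rewrite andbT (_ : val @^-1: _ = A) ?eqxx ?andbT //.
apply/setP=> u; rewrite inE mem_imset //; exact: val_inj.
Qed.

Lemma genus_isomorphic (G H : sgraph) : isomorphic G H -> genus G = genus H.
Proof.
move=> [f fiso]; have fE := is_iso_embedding fiso.
have [[g fK gK] _] := fiso.
rewrite !genusE [RHS](reindex_onto (fun A : {set G} => f @: A)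
                                   (fun A => g @: A)) /=.
  apply: eq_big => [A|A _]; last by rewrite card_imset //; exact: can_inj fK.
  rewrite clique_embedding // -imset_comp (eq_imset _ (fK : g \o f =1 id)).
  by rewrite imset_id eqxx andbT.
by move=> A _; rewrite -imset_comp (eq_imset _ (gK : f \o g =1 id)) imset_id.
Qed.

(** Removing [x] from the cliques that contain it gives the cliques of its unit
    sphere and reverses the sign. *)
Lemma genus_remove_vertex (G : sgraph) (x : G) :
  genus G = genus (remove_vertex x) - genus (unit_sphere x).
Proof.
rewrite !genus_induced genusE (bigID (fun A : {set G} => x \in A)) /= addrC.
congr (_ + _).
  by apply: eq_bigl => A; rewrite subsetC sub1set inE.
rewrite (reindex_onto (fun A => x |: A) (fun A => A :\ x)) /=; last first.
  by move=> A /andP[_]; exact: setD1K.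
have xS (A : {set G}) : A \subset nbhd x -> x \notin A.
  by move=> /subsetP Ax; apply/negP => /Ax; rewrite inE edge_irrefl.
rewrite -sumrN; apply: eq_big => A; last first.
  by case/andP=> _ /eqP xA; rewrite [in LHS](cardsD1 x) setU11 xA exprS mulN1r.
rewrite setU11 andbT.
apply/andP/andP => [[/cliqueP cxA /eqP xA]|[/cliqueP cA Ax]].
  have nxA : x \notin A by rewrite -xA !inE eqxx.
  split.
    by apply/cliqueP=> u v uA vA; apply: cxA; rewrite !inE ?uA ?vA orbT.
  apply/subsetP=> u uA; rewrite inE; apply: cxA; rewrite ?setU11 //.
    by rewrite !inE uA orbT.
  by apply: contraNneq nxA => ->.
split; last by rewrite setU1K ?xS.
move/subsetP: Ax => Ax.
apply/cliqueP=> u v /setU1P[->|uA] /setU1P[->|vA]; rewrite ?eqxx // => uv.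
- by have := Ax v vA; rewrite inE.
- by have := Ax u uA; rewrite inE edge_sym.
- exact: cA.
Qed.

Lemma genus_empty (G : sgraph) : #|G| = 0%N -> genus G = 1.
Proof. by move=> G0; rewrite /genus /euler_char G0 big_ord0 subr0. Qed.

Lemma genus_point (G : sgraph) : #|G| = 1%N -> genus G = 0.
Proof.
move=> G1; have /eqP/fintype1P[x xG] := G1.
rewrite (genus_remove_vertex x) !genus_empty ?subrr // card_induced.
  by apply: eq_card0 => y; rewrite inE (xG y) edge_irrefl.
by apply: eq_card0 => y; rewrite !inE (xG y) eqxx.
Qed.

Lemma genus_contractible (G : sgraph) : contractible G -> genus G = 0.
Proof.
elim=> {G} [G|G x _ S0 _ R0]; first exact: genus_point.
by rewrite (genus_remove_vertex x) S0 R0 subr0.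
Qed.

Lemma genus_dsphere (d : nat) (G : sgraph) :
  dsphere d G -> genus G = (-1) ^+ d.+1.
Proof.
elim: d G => [|d IHd] G /=.
  move=> [G2 Gn]; have /card_gt0P[x _] : (0 < #|G|)%N by rewrite G2.
  rewrite (genus_remove_vertex x) genus_point ?genus_empty //.
    rewrite card_induced; apply: eq_card0 => y.
    by rewrite inE (negbTE (Gn _ _)).
  by rewrite card_induced cardsC1 G2.
move=> [Gs [x cx]].
rewrite (genus_remove_vertex x) (genus_contractible cx) (IHd _ (Gs x)).
by rewrite sub0r [RHS]exprS mulN1r.
Qed.

Lemma genus_reduction (G H : sgraph) :
  homotopy_reduction G H -> genus G = genus H.
Proof.
case=> x cx xH; rewrite (genus_remove_vertex x) (genus_contractible cx) subr0.
exact: genus_isomorphic.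
Qed.

Lemma genus_homotopic (G H : sgraph) : homotopic G H -> genus G = genus H.
Proof.
elim=> {H} [H|H K _ -> /homotopy_extension_reduction/genus_reduction|
            H K _ -> /genus_reduction] //.
exact: genus_isomorphic.
Qed.

Lemma genus_sphere_or_contractible (G : sgraph) :
  sphere_or_contractible G -> genus G \in [:: -1; 0; 1].
Proof.
case=> [[S hS GS]|cG]; last by rewrite genus_contractible.
rewrite (genus_homotopic GS).
case: hS => [/genus_empty->//|[d /genus_dsphere->]].
by rewrite -signr_odd; case: odd.
Qed.

Local Close Scope ring_scope.

(** * The complement of a cycle *)

(** A walk upwards around the cycle from a point of [B] reaches [y], which is
    outside [B], so at some point it leaves [B]. *)
Lemma cycle_last (n : nat) (B : {set 'I_n}) (y : 'I_n) :
  y \notin B -> B != set0 ->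
  exists2 b, b \in B & forall c : 'I_n, c \in B -> b.+1 %% n != c.
Proof.
move=> yB /set0Pn[a aB].
have n0 : 0 < n by apply: leq_trans (ltn_ord y).
have [b /andP[bB /forallP bP]|noB] := pickP
    [pred b | (b \in B) && [forall c, (c \in B) ==> (b.+1 %% n != c)]].
  by exists b => // c; apply/implyP.
have stay m : exists2 c, c \in B & c = (a + m) %% n :> nat.
  elim: m => [|m [c cB cE]]; first by exists a; rewrite // addn0 modn_small.
  have /negbT := noB c; rewrite /= cB negb_forall => /existsP[d].
  rewrite negb_imply negbK => /andP[dB /eqP dE].
  by exists d => //; rewrite -dE cE -addn1 modnDml addn1 addnS.
have [c cB] := stay (n - a + y); rewrite addnA subnKC; last exact: ltnW.
rewrite modnDl modn_small // => /val_inj cy.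
by rewrite -cy cB in yB.
Qed.

Lemma cycle_succ_inj (n : nat) (c d : 'I_n) :
  c.+1 %% n = d.+1 %% n -> c = d.
Proof.
move=> cd; apply: val_inj; have /eqP := cd.
by rewrite -addn1 -[d.+1]addn1 eqn_modDr !modn_small // => /eqP.
Qed.

(** The vertex provided by [cycle_last] can only be adjacent to the one before
    it. *)
Lemma coforest_induced_compl_cycle (n : nat) (W : {set compl (cycle_graph n)})
    (y : 'I_n) :
  y \notin W -> coforest (induced W).
Proof.
move=> yW B B0.
pose pos (u : induced W) : 'I_n := val u.
have [||b] := @cycle_last n (pos @: B) y.
- by apply: contra yW => /imsetP[u _ ->]; exact: valP.
- by case/set0Pn: B0 => u uB; apply/set0Pn; exists (pos u); apply: imset_f.
case/imsetP=> u uB -> {b} last_u; exists u => //.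
apply/card_le1_eqP => c d.
have pred_u (v : induced W) : v \in [set v in B | compl_edge u v] ->
    (pos v).+1 %% n = pos u.
  rewrite inE /compl_edge /= /induced_edge /= /compl_edge /= /cycle_edge.
  case/and3P=> vB uv; rewrite (inj_eq val_inj) uv /= negbK.
  by case/orP=> /eqP // uv'; have /eqP[] := last_u (pos v) (imset_f _ vB).
move=> /pred_u cu /pred_u du; apply: val_inj; apply: cycle_succ_inj.
by rewrite cu du.
Qed.

Lemma coforest_sphere_intersection (n k : nat)
    (x : 'I_k -> compl (cycle_graph n)) :
  0 < k -> coforest (sphere_intersection x).
Proof.
move=> k0; apply: (@coforest_induced_compl_cycle _ _ (x (Ordinal k0))).
by apply/bigcapP => /(_ (Ordinal k0) isT); rewrite inE edge_irrefl.
Qed.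

Theorem theorem8 (n : nat) (hn : 3 <= n) (k : nat) (hk : 0 < k)
    (x : 'I_k -> compl (cycle_graph n)) :
  let H := sphere_intersection x in
  [/\ (exists W : {set cycle_graph n},
         (forall i : 'I_k, x i \notin W) /\
         exists2 f : H -> compl (induced W),
           is_iso f & forall u : H, sval (f u) = sval u),
      (exists (I : finType) (J : I -> sgraph),
         isomorphic H (zykov_join J) /\
         forall i : I, connected (compl (J i)) /\
           (homotopy_sphere (J i) \/ contractible (J i))),
      homotopy_sphere H \/ contractible H
    & genus H \in [:: (-1)%R; 0%R; 1%R]].
Proof.
move=> H; have cH : coforest H by apply: coforest_sphere_intersection.
have sH : sphere_or_contractible H.
  have sT := coforest_sphere_or_contractible setT cH.
  apply: sphere_or_contractible_isomorphic sT.
  exact/isomorphic_sym/isomorphic_induced_setT.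
split=> //; last exact: genus_sphere_or_contractible.
- exists (\bigcap_(i < k) nbhd (x i)); split.
    by move=> i; apply/bigcapP => /(_ i isT); rewrite inE edge_irrefl.
  by exists id => //; split=> //; exists id.
have [I [A [HJ cA]]] := join_decomposition H.
exists I, (fun i => induced (A i)); split=> // i; split; first exact: cA.
exact: coforest_sphere_or_contractible.
Qed.
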